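(* Let $M=\begin{pmatrix}A&B\\0&C\end{pmatrix}$ be the real $(m+2)\times(m+2)$ matrix described in the context, let $\theta\in[\tfrac12,1]$, $T>0$, and $\varphi(z)=\frac{1+(1-\theta)z}{1-\theta z}$. Suppose that $$rI+A \text{ is invertible},\qquad \mu_\infty[rI+A]\le 0,\qquad r+\alpha_m+|\beta_m|+|\gamma_m|\le 0,$$ and that $K$ is a real constant such that $$\|\varphi(\Delta t\,A)^n\|_\infty\le K\quad\text{whenever }\Delta t=T/N,\ 0\le n\le N,\ N\ge1 .$$ Then for every integer $N\ge 1$, with $\Delta t=T/N$, and for $1\le n\le N$, $$x^n+\left(1-x^n\right)\frac{2S}{h_{m+2}}\ \le\ \|\varphi(\Delta t\,M)^n\|_\infty\ \le\ K+\frac{4(K+1)S}{h_{m+2}}\qquad\text{with } x=\varphi(-r\,\Delta t).$$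
   Context: Let $m\ge 2$ be an integer, let $r>0$ and $S>0$ be real, and let $0=s_0<s_1<\dots<s_{m+1}<s_{m+2}=S$ be a (possibly non-uniform) grid with mesh widths $h_j=s_j-s_{j-1}$. $A$ is the real $m\times m$ tridiagonal matrix with diagonal entries $\alpha_1,\dots,\alpha_m$, subdiagonal entries $\beta_2,\dots,\beta_m$ ($\beta_i$ in position $(i,i-1)$) and superdiagonal entries $\gamma_1,\dots,\gamma_{m-1}$ ($\gamma_i$ in position $(i,i+1)$), all given real numbers. $B$ is the real $m\times 2$ matrix whose only possibly nonzero entry is a given real number $\gamma_m$ in position $(m,1)$. $C=\frac{r}{h_{m+2}}\begin{pmatrix}-S & s_{m+1}\\ -S& s_{m+1}\end{pmatrix}$, and $M=\begin{pmatrix}A&B\\0&C\end{pmatrix}$. For a square matrix $X$ with $I-\theta X$ invertible, $\varphi(X)=(I-\theta X)^{-1}(I+(1-\theta)X)$. In the application of the theorem, $K$ is meant to be independent of the dimension $m$ and of $n$. $\|\cdot\|_\infty$ is the matrix norm induced by the maximum norm (maximum absolute row sum), and $I$ is the identity matrix. The logarithmic maximum norm of a square matrix $X=(\xi_{ij})$ is $\mu_\infty[X]=\lim_{t\downarrow 0}\frac{\|I+tX\|_\infty-1}{t}=\max_i\{\xi_{ii}+\sum_{j\ne i}|\xi_{ij}|\}$. *)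

(* Defs.v *)
From HB Require Import structures.
From mathcomp Require Import all_boot all_order all_algebra.
From mathcomp Require Import all_classical all_reals all_analysis.
Set Implicit Arguments.
Unset Strict Implicit.
Unset Printing Implicit Defensive.
Import Order.TTheory GRing.Theory Num.Theory.
Import numFieldNormedType.Exports.
Local Open Scope classical_set_scope.
Local Open Scope ring_scope.

(* On column vectors `|v| is the maximum norm (mx_norm), so this is the matrix
   norm induced by the maximum norm; inf_normE gives the absolute row sums. *)
Definition inf_norm (R : realType) (n : nat) (X : 'M[R]_n) : R :=
  sup [set `|X *m v| | v in [set v : 'cV[R]_n | `|v| <= 1]].

Definition inf_log_norm (R : realType) (n : nat) (X : 'M[R]_n) : R :=
  lim ((fun t : R => (inf_norm (1%:M + t *: X) - 1) / t) @ 0^'+).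

Definition phi (R : realType) (theta z : R) : R :=
  (1 + (1 - theta) * z) / (1 - theta * z).

(* Meaningful when 1%:M - theta *: X is invertible: invmx is the identity on
   singular matrices. *)
Definition phi_mx (R : realType) (n : nat) (theta : R) (X : 'M[R]_n) : 'M[R]_n :=
  invmx (1%:M - theta *: X) *m (1%:M + (1 - theta) *: X).

Definition mesh (R : realType) (s : nat -> R) (j : nat) : R := s j - s j.-1.

(* The coefficients are numbered from 1, the rows and columns from 0. *)
Definition tridiag_mx (R : realType) (m : nat) (alpha beta gamma : nat -> R) :
    'M[R]_m :=
  \matrix_(i < m, j < m)
    if j == i :> nat then alpha i.+1
    else if j.+1 == i :> nat then beta i.+1
    else if j == i.+1 :> nat then gamma i.+1
    else 0.

Definition coupling_mx (R : realType) (m : nat) (gamma : nat -> R) :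
    'M[R]_(m, 2) :=
  \matrix_(i < m, j < 2)
    if (i.+1 == m :> nat) && (j == 0 :> nat) then gamma m else 0.

Definition boundary_mx (R : realType) (m : nat) (r S : R) (s : nat -> R) :
    'M[R]_2 :=
  (r / mesh s m.+2) *: \matrix_(i < 2, j < 2)
    if j == 0 :> nat then - S else s m.+1.

Definition full_mx (R : realType) (m : nat) (r S : R)
    (s alpha beta gamma : nat -> R) : 'M[R]_(m + 2) :=
  block_mx (tridiag_mx m alpha beta gamma) (coupling_mx m gamma)
           0 (boundary_mx m r S s).

Section NormFormulas.
Variable R : realType.

Lemma inf_normE (n : nat) (X : 'M[R]_n) :
  inf_norm X = \big[Num.max/0]_(i < n) \sum_(j < n) `|X i j|.
Proof.
set b := RHS.
have ubX : ubound [set `|X *m v| | v in [set v : 'cV[R]_n | `|v| <= 1]] b.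
  move=> _ [v /= v1 <-].
  rewrite [leLHS]/Num.Def.normr/= mx_normrE.
  apply: bigmax_le => [|[i k] _ /=]; first exact: bigmax_ge_id.
  apply: le_trans (le_bigmax_cond _ (fun i : 'I_n => \sum_j `|X i j|)
    (erefl : xpredT i)).
  rewrite mxE; apply: le_trans (ler_norm_sum _ _ _) _.
  apply: ler_sum => j _; rewrite normrM ler_piMr//.
  apply: le_trans v1; rewrite [leRHS]/Num.Def.normr/= mx_normrE.
  by apply: (le_bigmax_cond _ (fun p : 'I_n * 'I_1 => `|v p.1 p.2|)
    (erefl : xpredT (j, k))).
have nonempty : [set `|X *m v| | v in [set v : 'cV[R]_n | `|v| <= 1]] !=set0.
  by exists `|X *m (0 : 'cV_n)|, 0 => //=; rewrite normr0 ler01.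
apply/eqP; rewrite eq_le; apply/andP; split; first exact: ge_sup.
have supX := ub_le_sup (ex_intro _ b ubX).
apply: bigmax_le => [|i _].
  apply: le_trans (supX `|X *m (0 : 'cV_n)| _) => //.
  by exists 0 => //=; rewrite normr0 ler01.
pose v : 'cV[R]_n := \col_j Num.sg (X i j).
apply: le_trans (supX `|X *m v| _); last first.
  exists v => //=; rewrite [leLHS]/Num.Def.normr/= mx_normrE.
  apply: bigmax_le => // -[j k] _ /=; rewrite mxE normr_sg.
  by case: (X i j != 0).
have -> : \sum_j `|X i j| = (X *m v) i ord0.
  by rewrite mxE; apply: eq_bigr => j _; rewrite mxE mulrC -normrEsg.
apply: le_trans (ler_norm _) _.
rewrite [leRHS]/Num.Def.normr/= mx_normrE.
by apply: (le_bigmax_cond _ (fun p : 'I_n * 'I_1 => `|(X *m v) p.1 p.2|)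
  (erefl : xpredT (i, ord0))).
Qed.

Let logrow (n : nat) (X : 'M[R]_n) (i : 'I_n) : R :=
  X i i + \sum_(j < n | j != i) `|X i j|.

Lemma inf_log_norm_cvg (n : nat) (X : 'M[R]_n.+1) :
  ((inf_norm (1%:M + t *: X) - 1) / t) @[t --> 0^'+] -->
  \big[Num.max/logrow X ord0]_(i < n.+1) logrow X i.
Proof.
set L := \big[_/_]_(_ < _) _.
apply: cvg_near_cst.
pose c : R := 1 + \sum_(i < n.+1) `|X i i|.
have c0 : 0 < c by rewrite ltr_pwDl// sumr_ge0.
near=> t.
have t0 : 0 < t by near: t; exact: nbhs_right_gt.
have tc : t < c^-1.
  by near: t; apply: nbhs_right_lt; rewrite invr_gt0.
have rowE i : \sum_j `|(1%:M + t *: X) i j| = 1 + t * logrow X i.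
  rewrite (bigD1 i)//= !mxE eqxx mulr1n mulrDr addrA; congr (_ + _).
    rewrite ger0_norm// -lerBlDl sub0r.
    have : `|t * X i i| <= 1.
      rewrite normrM gtr0_norm//.
      apply: (@le_trans _ _ (c^-1 * c)); last by rewrite mulVf// gt_eqF.
      apply: ler_pM => //; [exact: ltW|].
      by rewrite /c (bigD1 i)//= addrCA lerDl addr_ge0// sumr_ge0.
    by rewrite ler_norml => /andP[].
  rewrite mulr_sumr; apply: eq_bigr => j ji.
  by rewrite !mxE eq_sym (negbTE ji) mulr0n add0r normrM gtr0_norm.
suff -> : inf_norm (1%:M + t *: X) = 1 + t * L.
  by rewrite addrAC subrr add0r mulrC mulKf// gt_eqF.
rewrite inf_normE; under eq_bigr do rewrite rowE.
apply/eqP; rewrite eq_le; apply/andP; split.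
  have leL i : 1 + t * logrow X i <= 1 + t * L.
    rewrite lerD2l ler_pM2l//.
    exact: (le_bigmax_cond _ (logrow X) (erefl : xpredT i)).
  apply: bigmax_le => [|i _]; last exact: leL.
  by apply: le_trans (leL ord0); rewrite -rowE sumr_ge0.
have [i ->] : exists i, L = logrow X i.
  rewrite /L; elim/big_ind: _ => [|x y [i ->] [j ->]|i _].
  - by exists ord0.
  - by case: (leP (logrow X i) (logrow X j)) => _; [exists j|exists i].
  - by exists i.
exact: (le_bigmax_cond _ (fun i => 1 + t * logrow X i) (erefl : xpredT i)).
Unshelve. all: by end_near. Qed.

Lemma inf_log_normE (n : nat) (X : 'M[R]_n.+1) :
  inf_log_norm X =
  \big[Num.max/X ord0 ord0 + \sum_(j < n.+1 | j != ord0) `|X ord0 j|]_(i < n.+1)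
    (X i i + \sum_(j < n.+1 | j != i) `|X i j|).
Proof. exact/cvg_lim/inf_log_norm_cvg. Qed.

End NormFormulas.

(* Main.v *)
Require Import Defs.
From HB Require Import structures.
From mathcomp Require Import all_boot all_order all_algebra.
From mathcomp Require Import all_classical all_reals all_analysis.
From mathcomp Require Import ring lra.
Set Implicit Arguments.
Unset Strict Implicit.
Unset Printing Implicit Defensive.
Import Order.TTheory GRing.Theory Num.Theory.
Import numFieldNormedType.Exports.
Local Open Scope classical_set_scope.
Local Open Scope ring_scope.

(* The matrix C has the eigenvectors (1, 1) and (s_{m+1}, S), with eigenvalues
   -r and 0. They extend to eigenvectors (u; 1, 1) and (s_{m+1} w; s_{m+1}, S)
   of M, where (r I + A) u = A w = - gamma_m e_m, and the dominance hypotheses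
   give |u|, |w| <= 1. Modulo these two eigenvectors every vector lies in the
   A-block, where phi(dt M)^n acts as phi(dt A)^n; this gives the upper bound.
   For the lower bound, take the last entry of phi(dt M)^n (0; -1, 1). *)

(** * The maximum norm on column vectors and the matrix norm it induces *)

Section MaximumNorm.
Variable R : realType.

Lemma norm_cV_leP (n : nat) (v : 'cV[R]_n) (c : R) : 0 <= c ->
  (`|v| <= c) <-> (forall i, `|v i ord0| <= c).
Proof.
move=> c0; rewrite [`|v|]/Num.Def.normr/= mx_normrE; split=> [vc i|vc].
  apply: le_trans vc.
  by apply: (le_bigmax_cond _ (fun p : 'I_n * 'I_1 => `|v p.1 p.2|)
    (erefl : xpredT (i, ord0))).
by apply: bigmax_le => // -[i j] _ /=; rewrite ord1.
Qed.

Lemma norm_cV_ge (n : nat) (v : 'cV[R]_n) i : `|v i ord0| <= `|v|.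
Proof. by case: (norm_cV_leP v (normr_ge0 v)) => le _; exact: le. Qed.

Lemma inf_norm_ge0 (n : nat) (X : 'M[R]_n) : 0 <= inf_norm X.
Proof. by rewrite inf_normE bigmax_ge_id. Qed.

Lemma norm_mulmx_le (n : nat) (X : 'M[R]_n) (v : 'cV[R]_n) :
  `|X *m v| <= inf_norm X * `|v|.
Proof.
apply/norm_cV_leP => [|i]; first by rewrite mulr_ge0 ?inf_norm_ge0.
rewrite mxE; apply: le_trans (ler_norm_sum _ _ _) _.
apply: (@le_trans _ _ ((\sum_j `|X i j|) * `|v|)).
  by rewrite mulr_suml ler_sum// => j _; rewrite normrM ler_wpM2l// norm_cV_ge.
rewrite ler_wpM2r// inf_normE.
by apply: (le_bigmax_cond _ (fun i : 'I_n => \sum_j `|X i j|)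
  (erefl : xpredT i)).
Qed.

Lemma inf_norm_le (n : nat) (X : 'M[R]_n) (c : R) :
  (forall v : 'cV[R]_n, `|v| <= 1 -> `|X *m v| <= c) -> inf_norm X <= c.
Proof.
move=> Xc; apply: ge_sup; last by move=> _ [v /= v1 <-]; exact: Xc.
by exists `|X *m (0 : 'cV_n)|, 0 => //=; rewrite normr0 ler01.
Qed.

End MaximumNorm.

(** * Diagonal dominance, invertibility and bounds on solutions *)

Section DiagonalDominance.
Variable R : realType.

(** One term of the maximum formula for the logarithmic norm. Rows are kept apart because right-hand
    sides are compared with the dominance of their own row. *)
Definition log_row (n : nat) (X : 'M[R]_n) (i : 'I_n) : R :=
  X i i + \sum_(j < n | j != i) `|X i j|.

Lemma log_row_le (n : nat) (X : 'M[R]_n) i : log_row X i <= inf_log_norm X.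
Proof.
case: n X i => [X []//|n] X i; rewrite inf_log_normE.
exact: (le_bigmax_cond _ (log_row X) (erefl : xpredT i)).
Qed.

Lemma log_row_scalar_add (n : nat) (X : 'M[R]_n) (a : R) i :
  log_row (a%:M + X) i = a + log_row X i.
Proof.
rewrite /log_row !mxE eqxx mulr1n -addrA; congr (_ + (_ + _)).
by apply: eq_bigr => j ji; rewrite !mxE eq_sym (negbTE ji) mulr0n add0r.
Qed.

Lemma log_row_scale (n : nat) (X : 'M[R]_n) (c : R) i : 0 <= c ->
  log_row (c *: X) i = c * log_row X i.
Proof.
move=> c0; rewrite /log_row mxE mulrDr mulr_sumr; congr (_ + _).
by apply: eq_bigr => j _; rewrite mxE normrM ger0_norm.
Qed.

Lemma unitmx_inj (n : nat) (X : 'M[R]_n) :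
  (forall v : 'cV[R]_n, X *m v = 0 -> v = 0) -> X \in unitmx.
Proof.
move=> X0; rewrite -unitmx_tr -row_free_unit -kermx_eq0.
apply/rowV0P => v /sub_kermxP vX; apply: trmx_inj; rewrite trmx0.
by apply: X0; apply: trmx_inj; rewrite trmx_mul trmxK vX trmx0.
Qed.

(** In a row [i] where [|v i|] is maximal, the off-diagonal terms are at most their absolute row sum
    times [|v i|], so [|(X v) i|] is at least [- log_row X i] times [|v i|]; dividing by this
    positive factor bounds the whole of [v]. *)
Lemma strict_dominance_bound (n : nat) (X : 'M[R]_n) (v : 'cV[R]_n) (c : R) :
  0 <= c -> (forall i, log_row X i < 0) ->
  (forall i, `|(X *m v) i ord0| <= c * - log_row X i) -> `|v| <= c.
Proof.
move=> c0 X0 Xv; apply/norm_cV_leP => //.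
case: n X v X0 Xv => [|n] X v X0 Xv k; first by case: k.
have [i _ imax] := @arg_maxP _ _ 'I_n.+1 ord0 xpredT (fun i => `|v i ord0|) erefl.
apply: le_trans (imax k erefl) _.
rewrite -(ler_pM2r (_ : 0 < - log_row X i)) ?oppr_gt0//.
apply: le_trans (Xv i).
rewrite mxE (bigD1 i)//= mulrC opprD mulrDl !mulNr.
set off := \sum_(j < n.+1 | j != i) X i j * v j ord0.
rewrite -[off]opprK; apply: le_trans (lerB_dist _ _); rewrite normrN.
apply: lerB; first by rewrite normrM -mulNr ler_wpM2r// -normrN ler_norm.
apply: le_trans (ler_norm_sum _ _ _) _; rewrite mulr_suml ler_sum// => j _.
by rewrite normrM ler_wpM2l//; exact: imax.
Qed.

Lemma strict_dominance_unitmx (n : nat) (X : 'M[R]_n) :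
  (forall i, log_row X i < 0) -> X \in unitmx.
Proof.
move=> X0; apply: unitmx_inj => v Xv; apply/eqP; rewrite -normr_le0.
by apply: (strict_dominance_bound _ X0) => // i; rewrite Xv mxE normr0 mul0r.
Qed.

(* The shift of [X] by [- t] makes the dominance strict; then [t] tends to [0]. *)
Lemma dominance_bound (n : nat) (X : 'M[R]_n) (v : 'cV[R]_n) :
  X \in unitmx -> (forall i, log_row X i <= 0) ->
  (forall i, `|(X *m v) i ord0| <= - log_row X i) -> `|v| <= 1.
Proof.
move=> Xu X0 Xv; apply/ler_addgt0Pr => e e0.
(* The correction [t *: (invmx X *m w)] will have norm at most [t * d = e]; the summand 1 keeps [d]
   positive. *)
pose d := inf_norm (invmx X) + 1.
have d0 : 0 < d by rewrite ltr_wpDl ?inf_norm_ge0.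
pose t := e / d; have t0 : 0 < t by rewrite divr_gt0.
pose Y := (- t)%:M + X.
have Y0 i : log_row Y i < 0.
  by rewrite log_row_scalar_add; have := X0 i; lra.
pose w := invmx Y *m (X *m v).
have Yw : Y *m w = X *m v by rewrite mulKVmx// strict_dominance_unitmx.
have w1 : `|w| <= 1.
  apply: (strict_dominance_bound _ Y0) => // i.
  rewrite Yw mul1r; apply: le_trans (Xv i) _.
  by rewrite log_row_scalar_add lerN2; lra.
(* From [Y *m w = X *m v] follows [X w = X v + t w]; apply the inverse of [X]. *)
have -> : v = w - t *: (invmx X *m w).
  rewrite -[LHS](mulKmx Xu) -Yw mulmxDl mul_scalar_mx mulmxDr mulKmx//.
  by rewrite scaleNr mulmxN -scalemxAr addrC.
apply: le_trans (ler_normB _ _) _; apply: lerD => //.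
rewrite normrZ gtr0_norm//.
apply: (@le_trans _ _ (t * d)); last by rewrite divfK// gt_eqF.
rewrite ler_pM2l//; apply: le_trans (norm_mulmx_le _ _) _.
apply: (@le_trans _ _ (inf_norm (invmx X))); last by rewrite lerDl.
by rewrite ler_piMr// inf_norm_ge0.
Qed.

(** The negated matrix [-1 + c X] has all its [log_row] values at most -1, hence is strictly
    dominant. *)
Lemma dominance_unitmx_1B (n : nat) (X : 'M[R]_n) (c : R) :
  0 <= c -> (forall i, log_row X i <= 0) -> 1%:M - c *: X \in unitmx.
Proof.
move=> c0 X0; rewrite -(unitmxZ _ (unitrN1 R)) scaleN1r opprB addrC -[- 1%:M]raddfN.
apply: strict_dominance_unitmx => i; rewrite log_row_scalar_add log_row_scale//.
by have := X0 i; nra.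
Qed.

End DiagonalDominance.

(** * The rational function phi of matrices and scalars *)

Section RationalFunction.
Variables (R : realType) (theta : R).

(** The relation [X Z = Z Y] passes to affine expressions, to inverses and to products, hence to
    powers of phi. With [Z] the inclusion of the A-block it reduces [M] to [A] there. *)
Lemma phi_mx_intertwine (p q : nat) (X : 'M[R]_p) (Y : 'M[R]_q)
    (Z : 'M[R]_(p, q)) (n : nat) :
  1%:M - theta *: X \in unitmx -> 1%:M - theta *: Y \in unitmx ->
  X *m Z = Z *m Y -> phi_mx theta X ^+ n *m Z = Z *m phi_mx theta Y ^+ n.
Proof.
move=> Xu Yu XZ.
have lin c : (1%:M + c *: X) *m Z = Z *m (1%:M + c *: Y).
  by rewrite mulmxDl mulmxDr mul1mx mulmx1 -scalemxAl XZ scalemxAr.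
have inv : invmx (1%:M - theta *: X) *m Z = Z *m invmx (1%:M - theta *: Y).
  apply: (can_inj (mulKmx Xu)); rewrite mulKVmx// mulmxA -scaleNr lin scaleNr.
  by rewrite mulmxK.
have step : phi_mx theta X *m Z = Z *m phi_mx theta Y.
  by rewrite /phi_mx -mulmxA lin !mulmxA inv.
elim: n => [|n IHn]; first by rewrite !expr0 mul1mx mulmx1.
by rewrite !exprS -mulmxA IHn mulmxA step -mulmxA.
Qed.

Lemma phi_mx_eigen (p : nat) (X : 'M[R]_p) (z : 'cV[R]_p) (a : R) (n : nat) :
  1%:M - theta *: X \in unitmx -> 1 - theta * a != 0 ->
  X *m z = a *: z -> phi_mx theta X ^+ n *m z = phi theta a ^+ n *: z.
Proof.
move=> Xu a0 Xz.
have lin c : (1%:M + c *: X) *m z = (1 + c * a) *: z.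
  by rewrite mulmxDl mul1mx -scalemxAl Xz scalerA scalerDl scale1r.
have step : phi_mx theta X *m z = phi theta a *: z.
  rewrite /phi_mx -mulmxA lin; apply: (can_inj (mulKmx Xu)).
  rewrite mulKVmx// -scaleNr -scalemxAr lin scalerA mulNr.
  by rewrite /phi divfK.
elim: n => [|n IHn]; first by rewrite !expr0 mul1mx scale1r.
by rewrite exprSr -mulmxA step -scalemxAr IHn scalerA -exprS.
Qed.

(** Stability of the theta-method on the nonpositive real axis: the numerator is at most the
    denominator because [a <= 0], and at least its negative because [(2 theta - 1) a <= 2]. *)
Lemma phi_norm_le1 (a : R) : 1 / 2 <= theta <= 1 -> a <= 0 ->
  `|phi theta a| <= 1.
Proof.
move=> /andP[th2 th1] a0; have d0 : 0 < 1 - theta * a by nra.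
rewrite /phi normrM normfV (gtr0_norm d0) ler_pdivrMr// mul1r ler_norml.
by apply/andP; split; nra.
Qed.

End RationalFunction.

(** * The blocks of the full matrix *)

Section BlockMatrix.
Variable R : realType.

Definition last_col (m : nat) : 'cV[R]_m := \col_(i < m) (i.+1 == m :> nat)%:R.

(** The entry [gamma m] lies in the coupling block, outside this row of A. The row therefore retains
    the slack [|gamma m|] granted by the separate hypothesis on the last row. The bound [2 <= m]
    ensures that the column of [beta m] exists. *)
Lemma log_row_tridiag_last (m : nat) (alpha beta gamma : nat -> R) (i : 'I_m) :
  (2 <= m)%N -> i.+1 = m ->
  log_row (tridiag_mx m alpha beta gamma) i = alpha m + `|beta m|.
Proof.
move=> m2 im; rewrite /log_row mxE eqxx im; congr (_ + _).
have jm : (i.-1 < m)%N by rewrite (leq_ltn_trans (leq_pred i)).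
have i0 : (0 < i)%N by rewrite -ltnS im.
have ji : (i.-1 == i :> nat) = false by rewrite ltn_eqF// prednK.
rewrite (bigD1 (Ordinal jm)) -?val_eqE/= ?ji// mxE/= ji prednK// eqxx im.
rewrite big1 ?addr0// => k /andP[ki kj].
rewrite mxE -[k == i :> nat]/(k == i) (negbTE ki) im (ltn_eqF (ltn_ord k)).
case: ifP => [/eqP ki1|]; last by rewrite normr0.
by move: kj; rewrite -val_eqE/= -ki1 eqxx.
Qed.

Lemma coupling_mulmx (m : nat) (gamma : nat -> R) (y : 'cV[R]_2) :
  coupling_mx m gamma *m y = (gamma m * y ord0 ord0) *: last_col m.
Proof.
apply/colP => i; rewrite !mxE !big_ord_recl big_ord0 !mxE/= andbF mul0r !addr0.
by rewrite andbT; case: ifP => _; rewrite ?mulr1 ?mulr0 ?mul0r.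
Qed.

Lemma boundary_mulmx (m : nat) (r S : R) (s : nat -> R) (y : 'cV[R]_2) :
  boundary_mx m r S s *m y =
  (r / mesh s m.+2 * (s m.+1 * y ord_max ord0 - S * y ord0 ord0)) *: const_mx 1.
Proof.
apply/colP => i; rewrite !mxE !big_ord_recl big_ord0 !mxE/= mulr1.
have -> : lift ord0 ord0 = ord_max :> 'I_2 by apply: val_inj.
ring.
Qed.

(** The boundary matrix has rank at most one with range in the constant vectors, so a kernel vector
    is constant, say [a]. Constants have eigenvalue [- r], whence [(1 + c r) a = 0]. *)
Lemma boundary_unitmx_1B (m : nat) (r S : R) (s : nat -> R) (c : R) :
  mesh s m.+2 != 0 -> s m.+2 = S -> 1 + c * r != 0 ->
  1%:M - c *: boundary_mx m r S s \in unitmx.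
Proof.
move=> h0 sS cr; apply: unitmx_inj => v /eqP.
rewrite mulmxBl mul1mx -scalemxAl boundary_mulmx scalerA subr_eq0 => /eqP vE.
set a := c * _ in vE.
have va i : v i ord0 = a by rewrite vE !mxE mulr1.
suff a0 : a = 0 by rewrite vE a0 scale0r.
have aE : a = - (c * r) * a.
  rewrite {1}/a !va -sS.
  have -> : s m.+2 = s m.+1 + mesh s m.+2 by rewrite /mesh/= addrC subrK.
  by field.
by apply: (mulfI cr); rewrite mulr0; lra.
Qed.

End BlockMatrix.

(** * The two-sided bound for powers of phi of the full matrix *)

Theorem theorem3 (R : realType) (m : nat) (r S : R)
    (s alpha beta gamma : nat -> R) (theta T K : R)
    (A := tridiag_mx m alpha beta gamma : 'M[R]_m)
    (M := full_mx m r S s alpha beta gamma : 'M[R]_(m + 2)) :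
  (2 <= m)%N -> 0 < r -> 0 < S ->
  s 0%N = 0 -> s m.+2 = S ->
  (forall j : nat, (j < m.+2)%N -> s j < s j.+1) ->
  1 / 2 <= theta <= 1 -> 0 < T ->
  r%:M + A \in unitmx ->
  inf_log_norm (r%:M + A) <= 0 ->
  r + alpha m + `|beta m| + `|gamma m| <= 0 ->
  (forall N n : nat, (1 <= N)%N -> (n <= N)%N ->
     inf_norm (phi_mx theta ((T / N%:R) *: A) ^+ n) <= K) ->
  forall N n : nat, (1 <= N)%N -> (1 <= n <= N)%N ->
  let dt := T / N%:R in
  let x := phi theta (- r * dt) in
  x ^+ n + (1 - x ^+ n) * (2 * S / mesh s m.+2)
    <= inf_norm (phi_mx theta (dt *: M) ^+ n)
    <= K + 4 * (K + 1) * S / mesh s m.+2.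
Proof.
move=> m2 r0 S0 s0 sS sinc th T0 Wu Wle Wlast AK N n N1 /andP[_ nN].
lazy zeta; set dt := T / N%:R; set x := phi theta (- r * dt).
have {}AK := AK N n N1 nN; rewrite -/dt in AK.
have th0 : 0 <= theta by case/andP: th; lra.
have dt0 : 0 < dt by rewrite divr_gt0// ltr0n.
clearbody dt.
set h := mesh s m.+2; set sm := s m.+1.
have h0 : 0 < h by rewrite subr_gt0 sinc.
have SE : S = sm + h by rewrite /h /mesh/= sS addrC subrK.
have sm0 : 0 < sm.
  have pos j : (j < m.+2)%N -> 0 < s j.+1.
    elim: j => [|j IHj] jm; first by rewrite -s0 sinc.
    by apply: lt_trans (sinc _ jm); exact/IHj/ltnW.
  exact: pos.
have Wrow i : log_row (r%:M + A) i <= 0 by apply: le_trans Wle; exact: log_row_le.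
(* Removing the shift by [r > 0] turns weak dominance into strict dominance. *)
have Arow i : log_row A i < 0.
  by have := Wrow i; rewrite log_row_scalar_add; lra.
pose b : 'cV[R]_m := - gamma m *: last_col R m.
(* Only the last entry of [b] can be nonzero, and there the claim is the hypothesis on the last
   row. *)
have Wb i : `|b i ord0| <= - log_row (r%:M + A) i.
  rewrite !mxE; case: eqP => [im|_]; last by rewrite mulr0 normr0 oppr_ge0.
  rewrite mulr1 normrN log_row_scalar_add log_row_tridiag_last//; lra.
have Ab i : `|b i ord0| <= - log_row A i.
  by apply: le_trans (Wb i) _; rewrite log_row_scalar_add; lra.
have Au : A \in unitmx by exact: strict_dominance_unitmx.
pose u := invmx (r%:M + A) *m b; pose w := invmx A *m b.
have uE : (r%:M + A) *m u = b by rewrite mulKVmx.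
have wE : A *m w = b by rewrite mulKVmx.
have u1 : `|u| <= 1 by apply: (dominance_bound Wu) => // i; rewrite uE.
have w1 : `|w| <= 1.
  by apply: (dominance_bound Au) => i; rewrite ?wE// ltW.
pose C := boundary_mx m r S s.
have ME v y : M *m col_mx v y =
    col_mx (A *m v - y ord0 ord0 *: b) (C *m y).
  rewrite mul_block_col mul0mx add0r coupling_mulmx; congr col_mx.
  by rewrite /b scalerA mulrN scaleNr opprK mulrC.
have Au1 : 1%:M - theta *: (dt *: A) \in unitmx.
  rewrite scalerA; apply: dominance_unitmx_1B; first by rewrite mulr_ge0// ltW.
  by move=> i; exact: ltW.
have Mu1 : 1%:M - theta *: (dt *: M) \in unitmx.
  rewrite unitmxE scalerA scalar_mx_block scale_block_mx opp_block_mx add_block_mx.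
  rewrite scaler0 oppr0 addr0 det_ublock unitrM -!unitmxE -scalerA Au1/=.
  apply: boundary_unitmx_1B => //; first by rewrite gt_eqF.
  by rewrite gt_eqF// ltr_wpDr// !mulr_ge0// ltW.
set Q := phi_mx theta (dt *: M) ^+ n; set P := phi_mx theta (dt *: A) ^+ n.
have QA v : Q *m col_mx v 0 = col_mx (P *m v) 0.
  (* The inclusion of the A-block, which satisfies [M E = E A]. *)
  pose E : 'M[R]_(m + 2, m) := col_mx 1%:M 0.
  have colE v' : col_mx v' 0 = E *m v' by rewrite mul_col_mx mul1mx mul0mx.
  rewrite !colE mulmxA (phi_mx_intertwine n Mu1 Au1) -?mulmxA//.
  rewrite -scalemxAl mul_block_col mulmx1 !mul0mx !mulmx0 !addr0.
  by rewrite mul_col_mx mul1mx mul0mx scale_col_mx scaler0.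
pose z1 : 'cV[R]_(m + 2) := col_mx u (const_mx 1).
(* A kernel vector of the boundary matrix. Its first entry [sm] feeds [- sm *: b] into the upper
   block, which [sm *: w] cancels. *)
pose yk : 'cV[R]_2 := \col_j if j == 0 :> nat then sm else S.
pose z0 : 'cV[R]_(m + 2) := col_mx (sm *: w) yk.
have Qz1 : Q *m z1 = x ^+ n *: z1.
  apply: phi_mx_eigen => //.
    by rewrite gt_eqF// mulNr mulrN opprK ltr_wpDr// !mulr_ge0// ltW.
  rewrite -scalemxAl [- r * dt]mulrC -scalerA; congr (_ *: _).
  rewrite /z1 ME boundary_mulmx scale_col_mx !mxE scale1r; congr col_mx.
    by rewrite -uE mulmxDl mul_scalar_mx opprD addrCA subrr addr0 scaleNr.
  by congr (_ *: _); rewrite -/h -/sm SE; field; rewrite gt_eqF.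
have Qz0 : Q *m z0 = z0.
  rewrite (@phi_mx_eigen _ _ _ _ _ 0)//.
  - by rewrite /phi !mulr0 !addr0 subr0 divr1 expr1n scale1r.
  - by rewrite mulr0 subr0 oner_neq0.
  rewrite -scalemxAl /z0 ME boundary_mulmx -scalemxAr wE !mxE/= subrr -/sm.
  by rewrite [sm * S]mulrC subrr mulr0 scale0r col_mx0 scaler0 scale0r.
(* Coordinates of [y] in the basis (1, 1), ([sm], [S]), whose determinant is [S - sm = h]. *)
pose ca (y : 'cV[R]_2) := (S * y ord0 ord0 - sm * y ord_max ord0) / h.
pose cb (y : 'cV[R]_2) := (y ord_max ord0 - y ord0 ord0) / h.
have QE v y : Q *m col_mx v y =
    col_mx (P *m (v - (ca y *: u + (cb y * sm) *: w))
            + (ca y * x ^+ n) *: u + (cb y * sm) *: w)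
           ((ca y * x ^+ n) *: const_mx 1 + cb y *: yk).
  have -> : col_mx v y = col_mx (v - (ca y *: u + (cb y * sm) *: w)) 0
      + ca y *: z1 + cb y *: z0.
    rewrite !scale_col_mx !add_col_mx scalerA -addrA subrK add0r; congr col_mx.
    apply/colP => i; rewrite !mxE mulr1 /ca /cb.
    case: (unliftP ord0 i) => [j ->|->] /=.
      rewrite (_ : lift ord0 j = ord_max); last by rewrite ord1; exact: val_inj.
      by rewrite SE; field; rewrite gt_eqF.
    by rewrite SE; field; rewrite gt_eqF.
  rewrite !(mulmxDr Q) QA -!scalemxAr Qz1 Qz0 scalerA.
  by rewrite !scale_col_mx !add_col_mx add0r scalerA.
have yk1 i : `|yk i ord0| <= S.
  by rewrite mxE; case: ifP => _; rewrite gtr0_norm// SE lerDl ltW.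
have K0 : 0 <= K by apply: le_trans AK; exact: inf_norm_ge0.
apply/andP; split.
  (* These signs maximize both [|ca y|] and [|cb y|] over the unit ball: [ca y = - (S + sm) / h] and
     [cb y = 2 / h]. The last entry [ca y * x ^+ n + cb y * S] of the image is then exactly the
     lower bound, since [sm = S - h]. *)
  pose y : 'cV[R]_2 := \col_j if j == 0 :> nat then -1 else 1.
  have v1 : `|col_mx (0 : 'cV[R]_m) y| <= 1.
    apply/norm_cV_leP => // i; case: (split_ordP i) => j ->.
      by rewrite col_mxEu mxE normr0.
    by rewrite col_mxEd mxE; case: ifP; rewrite ?normrN normr1.
  apply: (@le_trans _ _ `|Q *m col_mx 0 y|); last first.
    by apply: le_trans (norm_mulmx_le _ _) _; rewrite ler_piMr// inf_norm_ge0.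
  apply: le_trans (norm_cV_ge _ (rshift m ord_max)).
  apply: le_trans (ler_norm _).
  rewrite QE col_mxEd !mxE/= /ca /cb !mxE/= le_eqVlt; apply/orP; left.
  by apply/eqP; rewrite SE; field; rewrite gt_eqF.
have x1 : `|x ^+ n| <= 1.
  by rewrite normrX exprn_ile1// phi_norm_le1// mulNr oppr_le0 mulr_ge0 ?ltW.
apply: inf_norm_le => v v1.
rewrite -[v]vsubmxK QE; set va := usubmx v; set y := dsubmx v.
have va1 : `|va| <= 1.
  apply/norm_cV_leP => // i; rewrite mxE; exact: le_trans (norm_cV_ge _ _) v1.
have y1 i : `|y i ord0| <= 1.
  by rewrite mxE; exact: le_trans (norm_cV_ge _ _) v1.
have a1 : `|ca y| <= (S + sm) / h.
  rewrite /ca normrM normfV (gtr0_norm h0) ler_pM2r ?invr_gt0//.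
  apply: le_trans (ler_normB _ _) _; rewrite !normrM (gtr0_norm S0) (gtr0_norm sm0).
  by apply: lerD; rewrite ler_piMr ?y1 ?ltW.
have b1 : `|cb y| <= 2 / h.
  rewrite /cb normrM normfV (gtr0_norm h0) ler_pM2r ?invr_gt0//.
  by apply: le_trans (ler_normB _ _) _; rewrite -[2]/(1 + 1) lerD.
have ax1 : `|ca y * x ^+ n| <= (S + sm) / h.
  by apply: le_trans a1; rewrite normrM ler_piMr.
have bs1 : `|cb y * sm| <= 2 * sm / h.
  by rewrite normrM (gtr0_norm sm0) mulrAC ler_pM2r.
have -> : K + 4 * (K + 1) * S / h = K + (K + 1) * (4 * (S / h)) by ring.
(* The left side bounds the part along the two eigenvectors in the upper block; it is
   [(S + 3 sm) / h], and [sm <= S]. *)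
have shE : (S + sm) / h + 2 * sm / h <= 4 * (S / h).
  rewrite -mulrDl mulrA ler_pM2r ?invr_gt0//; lra.
have Sh0 : 0 <= S / h by rewrite divr_ge0// ltW.
apply/norm_cV_leP => [|i]; first by nra.
case: (split_ordP i) => j ->; rewrite ?col_mxEu ?col_mxEd.
  apply: le_trans (norm_cV_ge _ _) _.
  have au : `|ca y *: u| <= (S + sm) / h.
    by rewrite normrZ; apply: le_trans a1; rewrite ler_piMr.
  have axu : `|(ca y * x ^+ n) *: u| <= (S + sm) / h.
    by rewrite normrZ; apply: le_trans ax1; rewrite ler_piMr.
  have bw : `|(cb y * sm) *: w| <= 2 * sm / h.
    by rewrite normrZ; apply: le_trans bs1; rewrite ler_piMr.
  (* The shift [t] is paid for twice: once multiplied by [K] under [P], once when the eigenvector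
     parts are added back. This produces the factor [K + 1]. *)
  set t := ca y *: u + _; have t1 : `|t| <= (S + sm) / h + 2 * sm / h.
    by apply: le_trans (ler_normD _ _) _; exact: lerD.
  have Pt : `|P *m (va - t)| <= K * (1 + ((S + sm) / h + 2 * sm / h)).
    apply: le_trans (norm_mulmx_le _ _) _; apply: ler_pM => //.
      exact: inf_norm_ge0.
    by apply: le_trans (ler_normB _ _) _; exact: lerD.
  apply: le_trans (ler_normD _ _) _.
  apply: le_trans (lerD (ler_normD _ _) bw) _.
  apply: le_trans (lerD (lerD Pt axu) (lexx _)) _.
  by have := ler_wpM2l K0 shE; lra.
rewrite !mxE mulr1; apply: le_trans (ler_normD _ _) _.
have bk : `|cb y * yk j ord0| <= 2 / h * S by rewrite normrM ler_pM.
rewrite mxE in bk; apply: le_trans (lerD ax1 bk) _.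
have := mulr_ge0 K0 Sh0.
(* The two boundary entries stay below [4 S / h], so the terms with [K] only add room. *)
have -> : (S + sm) / h + 2 / h * S = 4 * (S / h) - (S - sm) / h by ring.
have : 0 <= (S - sm) / h by rewrite SE addrC addKr divff ?gt_eqF.
nra.
Qed.
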